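(* Let $b\ge2$, $t\ge1$ and $n\ge(t+1)b-1$. Then \[ N^-_{2,b}(n,t)=D_{2,b}(n,t)-D_{2,b}(n-b,t)+D_{2,b}(n-3b,t-2)=D_{2,b}(n,t)-\binom{n-(t+1)b+1}{t}, \] where $D_{2,b}(n,t)=\sum_{i=0}^{t}\binom{n-bt}{i}$.
   Context: $\Sigma_2=\{0,1\}$. A $b$-burst-deletion at position $i\in[1,n-b+1]$ transforms $x_1\cdots x_n$ into $x_1\cdots x_{i-1}x_{i+b}\cdots x_n$. For $n\ge tb+1$, $t\ge0$, $\mathcal{D}_{t,b}(\boldsymbol{x})$ is the set of all length-$(n-tb)$ sequences obtainable from $\boldsymbol{x}$ by $t$ successive $b$-burst-deletions ($\mathcal{D}_{0,b}(\boldsymbol{x})=\{\boldsymbol{x}\}$). For $m\ge bs+1$, $s\ge0$: $D_{2,b}(m,s)=\max\{|\mathcal{D}_{s,b}(\boldsymbol{x})|:\boldsymbol{x}\in\Sigma_2^m\}$; conventions $D_{2,b}(m,s)=1$ if $m=bs\ge0$, and $D_{2,b}(m,s)=0$ if $m<bs$ or $s<0$. $N^-_{2,b}(n,t)=\max\{|\mathcal{D}_{t,b}(\boldsymbol{x})\cap\mathcal{D}_{t,b}(\boldsymbol{y})|:\boldsymbol{x}\ne\boldsymbol{y}\in\Sigma_2^n\}$. Convention: $\binom{m}{i}=0$ if $m<i$. *)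

(* Defs.v *)
From mathcomp Require Import all_boot all_order all_algebra.
Set Implicit Arguments. Unset Strict Implicit. Unset Printing Implicit Defensive.
Import GRing.Theory Num.Theory.

(* Binary sequences are [seq bool]; positions are 0-indexed here:
   a b-burst-deletion at 0-indexed position i, 0 <= i <= size x - b,
   removes x_i ... x_{i+b-1}. *)
Definition burst_del (b : nat) (x : seq bool) (i : nat) : seq bool :=
  take i x ++ drop (i + b) x.

Definition bursts (b : nat) (x : seq bool) : seq (seq bool) :=
  if b <= size x then [seq burst_del b x i | i <- iota 0 (size x - b).+1]
  else [::].

(* list (possibly with repetitions) of all sequences obtained from x by
   t successive b-burst-deletions; D_{t,b}(x) is its underlying set *)
Fixpoint Dlist (b t : nat) (x : seq bool) : seq (seq bool) :=
  match t with
  | 0 => [:: x]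
  | t'.+1 => flatten [seq bursts b y | y <- Dlist b t' x]
  end.

Definition Dcard (b t : nat) (x : seq bool) : nat := size (undup (Dlist b t x)).

(* D_{2,b}(m,s) with the conventions for m <= bs and s < 0 (m, s integers) *)
Definition Dmax (b : nat) (m s : int) : nat :=
  match m, s with
  | Posz m', Posz s' =>
      if m' < b * s' then 0
      else if m' == b * s' then 1
      else \max_(x : m'.-tuple bool) Dcard b s' x
  | _, _ => 0
  end.

Definition Icard (b t : nat) (x y : seq bool) : nat :=
  size (undup [seq z <- Dlist b t x | z \in Dlist b t y]).

Definition Nminus (b n t : nat) : nat :=
  \max_(x : n.-tuple bool) \max_(y : n.-tuple bool | y != x) Icard b t x y.

(* Main.v *)
(* A word z lies in D_{t,b}(x) iff it embeds in x with all gaps multiples of b,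
   and the embedding may be taken greedily: the first letter c of z is matched
   with the first of x_0, x_b, x_{2b}, ... equal to c.  Writing m = n - bt for
   the output length and S(m, u) = sum_{i < u} C(m, i), greediness and Pascal's
   rule S(m+1, t+1) = S(m, t+1) + S(m, t) give |D_{t,b}(x)| <= S(m, t+1), with
   equality when x_{i+b} <> x_i for all i.

   For x <> y at least C(m+1-b, t) words are lost, by induction on m.
   If x_0 <> y_0, both branches have at most S(m-1, t) words.
   If x_0 = y_0 = a, the branch starting with ~a spends one burst on each of x
   and y and reaches drop (b+1) of both, unless x_b or y_b is a, in which case
   it spends two bursts and loses enough.  When the two suffixes differ,
   induction applies to both branches; when they agree, x and y differ only
   among their first b letters, which count_common_window handles.
   Equality holds for x with x_{i+b} <> x_i throughout and y obtained from x by
   flipping the letter x_{b-1}. *)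
Require Import Defs.
From mathcomp Require Import all_boot all_order all_algebra.
From mathcomp Require Import zify.
Set Implicit Arguments. Unset Strict Implicit. Unset Printing Implicit Defensive.
Import GRing.Theory Num.Theory.

Local Open Scope nat_scope.
Implicit Types (b t m k : nat) (x y z : seq bool) (a c : bool).

(** * Embeddings with gaps divisible by [b], and their equivalence with iterated burst deletion *)

(* Here j counts the bursts deleted before the first letter of z is matched. *)
Fixpoint emb b t x z : bool :=
  if z is c :: z' then
    has (fun j => [&& j * b < size x, nth false x (j * b) == c
                    & emb b (t - j) (drop (j * b).+1 x) z']) (iota 0 t.+1)
  else size x == b * t.

Arguments emb : simpl never.

Lemma emb_nil b t x : emb b t x [::] = (size x == b * t).
Proof. by []. Qed.

Lemma emb_consP b t x c z :
  reflect (exists j, [/\ j <= t, j * b < size x, nth false x (j * b) = c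
                       & emb b (t - j) (drop (j * b).+1 x) z])
          (emb b t x (c :: z)).
Proof.
apply: (iffP hasP) => [[j]|[j [jt jx jc je]]].
  by rewrite mem_iota => jt /and3P[jx /eqP jc je]; exists j; split=> //; lia.
by exists j; rewrite ?mem_iota ?jx ?jc ?eqxx //; lia.
Qed.

Lemma emb_size b t x z : emb b t x z -> size x = size z + b * t.
Proof.
elim: z t x => [|c z IH] t x; first by rewrite emb_nil => /eqP.
case/emb_consP=> j [jt jx _ /IH]; rewrite size_drop /=.
have : b * t = b * (t - j) + j * b by rewrite [j * b]mulnC -mulnDr subnK.
lia.
Qed.

(** Bursts that remove a prefix merge into the first gap of the embedding, so its [j] becomes
    [j + k]. *)
Lemma emb_drop b t k x z :
  k * b <= size x -> emb b t (drop (k * b) x) z -> emb b (t + k) x z.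
Proof.
move=> kx; case: z => [|c z].
  by rewrite !emb_nil size_drop => /eqP ?; apply/eqP; lia.
case/emb_consP=> j [jt]; rewrite size_drop nth_drop drop_drop => jx jc je.
apply/emb_consP; exists (j + k); split; [lia|lia| |].
  by rewrite mulnDl addnC.
by rewrite subnDr mulnDl -addSn.
Qed.

(** A match at the head can replace any later one: the bursts of the first gap are then performed
    just after the head. *)
Lemma emb_cons b t a x z : emb b t (a :: x) (a :: z) = emb b t x z.
Proof.
apply/idP/idP => [|e]; last first.
  by apply/emb_consP; exists 0; split; rewrite ?subn0 ?mul0n /= ?drop0.
case/emb_consP=> -[|j] [jt jx _]; first by rewrite subn0 mul0n /= drop0.
rewrite /= => je; rewrite -(subnK jt); exact: emb_drop.
Qed.

Lemma emb_skip b t x z : b <= size x -> emb b t (drop b x) z -> emb b t.+1 x z.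
Proof. by move=> bx e; rewrite -addn1; apply: emb_drop; rewrite mul1n. Qed.

Lemma emb_cat b t s x z : emb b t x z -> emb b t (s ++ x) (s ++ z).
Proof. by elim: s => //= a s IH /IH; rewrite emb_cons. Qed.

Lemma emb0 b x z : emb b 0 x z = (x == z).
Proof.
elim: z x => [|c z IH] x; first by rewrite emb_nil muln0 size_eq0.
case: x => [|a x]; first by apply/negP => /emb_consP[j []].
by rewrite /emb /= -/emb orbF drop0 IH eqseq_cons.
Qed.

Lemma drop_cons_nth b a x : 0 < b -> b <= size x ->
  drop b (a :: x) = nth false x b.-1 :: drop b x.
Proof. by case: b => // b _ bx; apply: drop_nth. Qed.

(** The head [a] forces at least one burst, and after exactly one the wanted letter is at the front,
    where [emb_cons] allows matching it. *)
Lemma emb_greedy b t a x z :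
  0 < b -> b <= size x -> nth false x b.-1 = ~~ a ->
  emb b t.+1 (a :: x) (~~ a :: z) = emb b t (drop b x) z.
Proof.
move=> b0 bx xb; have dx := drop_cons_nth a b0 bx; rewrite xb in dx.
apply/idP/idP => [|e]; last first.
  by apply: emb_skip => /=; [lia|rewrite dx emb_cons].
case/emb_consP=> -[|j] [jt jx]; first by case: (a).
move=> jc je; rewrite -(emb_cons _ _ (~~ a)) -dx.
apply/emb_consP; exists j; split=> //.
- by rewrite size_drop; move: jx => /=; lia.
- by rewrite nth_drop -mulSn.
- by rewrite drop_drop addSn addnC -mulSn.
Qed.

Lemma emb_drop_suffix b t k x y : emb b t x y -> k <= size y ->
  exists2 j, j <= t
    & k + j * b <= size x /\ emb b (t - j) (drop (k + j * b) x) (drop k y).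
Proof.
elim: k t x y => [|k IH] t x y e ky.
  by exists 0; rewrite // mul0n drop0 subn0 drop0.
case: y e ky => // c y /emb_consP[j [jt jx _ je]] /= ky.
have [i it [ix ie]] := IH _ _ _ je ky.
exists (i + j); first lia.
rewrite size_drop in ix; rewrite drop_drop in ie; split; first lia.
have -> : k.+1 + (i + j) * b = k + i * b + (j * b).+1 by lia.
by rewrite addnC subnDA.
Qed.

Lemma emb_burst b t x y i : emb b t x y -> i + b <= size y ->
  emb b t.+1 x (take i y ++ drop (i + b) y).
Proof.
elim: i t x y => [|i IH] t x y e iy.
  rewrite take0 /= add0n.
  have [j jt [jx je]] := emb_drop_suffix e iy.
  (* The [b] deleted letters of [y] and the [j] bursts in their gaps together form [j.+1] bursts of
     [x]. *)
  rewrite -mulSn in jx je.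
  by rewrite -(subnK (jt : j.+1 <= t.+1)) subSS; apply: emb_drop.
case: y e iy => // c y /emb_consP[j [jt jx jc je]] /= iy.
apply/emb_consP; exists j; split=> //; first lia.
by rewrite subSn //; apply: IH.
Qed.

Lemma emb_unburst b t x z : emb b t.+1 x z ->
  exists y i, [/\ emb b t x y, i + b <= size y & z = burst_del b y i].
Proof.
(* If the first gap contains a burst, restoring its [b] letters in front of the output gives [y];
   otherwise the heads match and are peeled off. *)
have skip x' z' : b <= size x' -> emb b t (drop b x') z' ->
    exists y i, [/\ emb b t x' y, i + b <= size y & z' = burst_del b y i].
  move=> bx e; have sb : size (take b x') = b by rewrite size_takel.
  exists (take b x' ++ z'), 0; split.
  - by rewrite -{1}(cat_take_drop b x'); apply: emb_cat.
  - by rewrite size_cat sb; lia.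
  - by rewrite /burst_del take0 add0n /= drop_size_cat.
elim: z x => [|c z IH] x e; have sx := emb_size e.
  rewrite /= mulnS in sx; apply: skip; first lia.
  by rewrite emb_nil size_drop; apply/eqP; lia.
rewrite mulnS in sx.
case/emb_consP: e => -[|j] [jt jx jc]; rewrite ?subn0 => je.
  case: x jx jc je sx => // a x _ /= ->; rewrite drop0 => je sx.
  have [y [i [ey iy ->]]] := IH _ je.
  by exists (c :: y), i.+1; rewrite emb_cons.
apply: skip; first lia.
apply/emb_consP; exists j; split=> //.
- by rewrite size_drop; lia.
- by rewrite nth_drop -mulSn.
- by rewrite drop_drop addSn [j * b + b]addnC -mulSn.
Qed.

Lemma mem_bursts b y z : reflect
  (exists2 i, i + b <= size y & z = burst_del b y i) (z \in bursts b y).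
Proof.
rewrite /bursts; case: leqP => by_; last first.
  by apply: (iffP idP) => // -[i]; lia.
apply: (iffP mapP) => -[i].
  by rewrite mem_iota => iy ->; exists i => //; lia.
by move=> iy ->; exists i => //; rewrite mem_iota; lia.
Qed.

Lemma mem_Dlist b t x z : (z \in Dlist b t x) = emb b t x z.
Proof.
elim: t z => [|t IH] z; first by rewrite emb0 inE eq_sym.
apply/flatten_mapP/idP => [[y]|].
  by rewrite IH => e /mem_bursts[i iy ->]; apply: emb_burst.
case/emb_unburst=> y [i [ey iy ->]]; exists y; first by rewrite IH.
by apply/mem_bursts; exists i.
Qed.

(** * Cardinalities as counts over all words of a fixed length, split by first letter *)

Fixpoint words m : seq (seq bool) :=
  if m is m'.+1 then map (cons true) (words m') ++ map (cons false) (words m')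
  else [:: [::]].

Lemma mem_words m z : (z \in words m) = (size z == m).
Proof.
elim: m z => [|m IH] z; first by rewrite inE size_eq0.
rewrite /= mem_cat; apply/orP/eqP => [[]/mapP[z' + ->]|].
- by rewrite IH /= => /eqP ->.
- by rewrite IH /= => /eqP ->.
case: z => // -[] z /= [zm]; [left|right].
- by apply: map_f; rewrite IH zm.
- by apply: map_f; rewrite IH zm.
Qed.

Lemma uniq_words m : uniq (words m).
Proof.
elim: m => //= m IH.
rewrite cat_uniq !map_inj_uniq ?IH //= ?andbT; try by move=> ? ? [].
by apply/hasPn => z /mapP[z' _ ->]; apply/mapP => -[].
Qed.

Lemma count_wordsS m (P : pred (seq bool)) a : count P (words m.+1) =
  count (fun z => P (a :: z)) (words m)
  + count (fun z => P (~~ a :: z)) (words m).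
Proof.
by rewrite /= count_cat !count_map; case: a => //; rewrite addnC.
Qed.

Arguments words : simpl never.

Lemma count_words0 (P : pred (seq bool)) : count P (words 0) = P [::].
Proof. by rewrite /= addn0. Qed.

Lemma size_undup_words m (s : seq (seq bool)) :
  {in s, forall z, size z = m} -> size (undup s) = count (mem s) (words m).
Proof.
move=> sm; rewrite -size_filter; apply/perm_size/uniq_perm.
- exact: undup_uniq.
- by rewrite filter_uniq ?uniq_words.
move=> z; rewrite mem_undup mem_filter mem_words /=.
by case: (boolP (z \in s)) => //= /sm ->; rewrite eqxx.
Qed.

Lemma DcardE b t m x : size x = m + b * t ->
  Dcard b t x = count (emb b t x) (words m).
Proof.
move=> sx; rewrite /Dcard (@size_undup_words m).
  by apply: eq_count => z; rewrite /= mem_Dlist.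
by move=> z; rewrite mem_Dlist => /emb_size; lia.
Qed.

Definition common b t x y z := emb b t x z && emb b t y z.

Lemma IcardE b t m x y : size x = m + b * t ->
  Icard b t x y = count (common b t x y) (words m).
Proof.
move=> sx; rewrite /Icard (@size_undup_words m).
  by apply: eq_count => z; rewrite /= mem_filter !mem_Dlist andbC.
by move=> z; rewrite mem_filter !mem_Dlist => /andP[_ /emb_size]; lia.
Qed.

(** * Partial sums of binomial coefficients *)

Definition binsum m u := \sum_(i < u) 'C(m, i).

Lemma binsum0 m : binsum m 0 = 0.
Proof. by rewrite /binsum big_ord0. Qed.

Lemma binsum_recr m u : binsum m u.+1 = binsum m u + 'C(m, u).
Proof. by rewrite /binsum big_ord_recr. Qed.

Lemma binsum_pascal m u : binsum m.+1 u.+1 = binsum m u.+1 + binsum m u.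
Proof.
elim: u => [|u IH]; first by rewrite !binsum_recr !binsum0 !bin0.
rewrite binsum_recr IH (binsum_recr m u.+1) (binsum_recr m u) binS; lia.
Qed.

Lemma binsum0l u : binsum 0 u.+1 = 1.
Proof.
elim: u => [|u IH]; first by rewrite binsum_recr binsum0.
by rewrite binsum_recr IH bin0n.
Qed.

Lemma leq_binsum m u v : u <= v -> binsum m u <= binsum m v.
Proof.
elim: v => [|v IH]; first by rewrite leqn0 => /eqP ->.
by rewrite leq_eqVlt => /predU1P[->//|/IH]; rewrite binsum_recr; lia.
Qed.

(** * Upper bounds for one word and for two distinct words *)

Definition avoids b j c x :=
  forall i, i < j -> i * b < size x -> nth false x (i * b) != c.

(* Avoiding c at 0, b, ..., (j-1)b forces at least j bursts before an output
   letter c; the truncated t.+1 - j makes the bound 0 when j > t. *)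
Lemma count_emb_avoids b m :
  (forall t x, count (emb b t x) (words m) <= binsum m t.+1) ->
  forall j t x c, avoids b j c x ->
  count (fun z => emb b t x (c :: z)) (words m) <= binsum m (t.+1 - j).
Proof.
move=> IH j t x c; have [d] := ubnP (t.+1 - j).
elim: d j => // d IHd j jd av; case: (ltnP t j) => [tj|jt].
  rewrite (@eq_in_count _ _ pred0) ?count_pred0 // => z _ /=.
  by apply/negP => /emb_consP[i [it ix /eqP]]; rewrite (negPf (av _ _ ix)) //; lia.
have [/andP[jx /eqP jc]|nj] :=
    boolP ((j * b < size x) && (nth false x (j * b) == c)).
  rewrite subSn //; apply: leq_trans (IH (t - j) (drop (j * b).+1 x)).
  apply: sub_count => z /emb_consP[i [it ix ic ie]].
  have ji : j <= i.
    by rewrite leqNgt; apply/negP => /av/(_ ix); rewrite ic eqxx.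
  have -> : t - j = (t - i) + (i - j) by lia.
  have e : (i * b).+1 = (i - j) * b + (j * b).+1.
    by rewrite addnS -mulnDl subnK.
  by apply: emb_drop; rewrite ?size_drop ?drop_drop -?e //; lia.
(* Position [j * b] is out of range or carries another letter, so avoidance extends to [j.+1], which
   only sharpens the bound. *)
apply: leq_trans (IHd j.+1 _ _) _; [lia| |by apply: leq_binsum; lia].
move=> i; rewrite ltnS leq_eqVlt => /predU1P[-> jx|/av//].
by rewrite jx in nj.
Qed.

Lemma avoids1 b c x : nth false x 0 != c -> avoids b 1 c x.
Proof. by move=> xc [|i]. Qed.

Lemma avoids2 b c x : nth false x 0 != c ->
  (b < size x -> nth false x b != c) -> avoids b 2 c x.
Proof. by move=> x0 xb [|[|i]] //; rewrite mul1n. Qed.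

Lemma count_emb_le b t x m : count (emb b t x) (words m) <= binsum m t.+1.
Proof.
elim: m t x => [|m IH] t x; first by rewrite binsum0l count_words0; case: emb.
rewrite (count_wordsS _ _ (nth false x 0)) binsum_pascal; apply: leq_add.
  by rewrite -[t.+1]subn0; apply: count_emb_avoids.
have/(count_emb_avoids IH t): avoids b 1 (~~ nth false x 0) x.
  by apply: avoids1; case: nth.
by rewrite subSS subn0.
Qed.

Lemma count_common_avoidsl b m j t x y c : avoids b j c x ->
  count (fun z => common b t x y (c :: z)) (words m) <= binsum m (t.+1 - j).
Proof.
move=> av; apply: leq_trans (count_emb_avoids (fun u w => count_emb_le b u w m) t av).
by apply: sub_count => z /andP[].
Qed.

Lemma common_sym b t x y : common b t x y =1 common b t y x.
Proof. by move=> z; rewrite /common andbC. Qed.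

Lemma count_common_avoidsr b m j t x y c : avoids b j c y ->
  count (fun z => common b t x y (c :: z)) (words m) <= binsum m (t.+1 - j).
Proof.
move=> av; rewrite (eq_count (a2 := fun z => common b t y x (c :: z))).
  exact: count_common_avoidsl.
by move=> z; apply: common_sym.
Qed.

Lemma common_cons b t a x y z :
  common b t (a :: x) (a :: y) (a :: z) = common b t x y z.
Proof. by rewrite /common !emb_cons. Qed.

Lemma common_t0 b x y m : x != y -> count (common b 0 x y) (words m) = 0.
Proof.
move=> xy; rewrite (@eq_count _ _ pred0) ?count_pred0 // => z /=.
rewrite /common !emb0; apply/negP => /andP[/eqP xz /eqP yz].
by rewrite xz yz eqxx in xy.
Qed.

(** Isolates the loss when one branch spends one burst and the other two. *)
Lemma binsum2 m t : binsum m.+1 t.+1 = binsum m t + binsum m t.-1 + 'C(m.+1, t).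
Proof.
case: t => [|t]; first by rewrite binsum_recr !binsum0 !bin0.
rewrite /= binsum_pascal binS (binsum_recr m t.+1) {2}(binsum_recr m t); lia.
Qed.

Lemma count_common_heads b m t a x y i j :
  avoids b i a (~~ a :: y) -> avoids b j (~~ a) (a :: x) ->
  count (common b t (a :: x) (~~ a :: y)) (words m.+1)
    <= binsum m (t.+1 - i) + binsum m (t.+1 - j).
Proof.
move=> avy avx; rewrite (count_wordsS _ _ a); apply: leq_add.
  exact: count_common_avoidsr.
exact: count_common_avoidsl.
Qed.

Lemma head_neq a x : nth false (a :: x) 0 != ~~ a.
Proof. by case: a. Qed.

Lemma head_negb_neq a x : nth false (~~ a :: x) 0 != a.
Proof. by case: a. Qed.

(** Equal heads are peeled off, shrinking the window. Once the heads differ, the letters at distance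
    [b] lie beyond the window and agree, so one of the two branches meets the wrong letter twice and
    spends two bursts. *)
Lemma count_common_window b k m t x y : k < b ->
  size x = size y -> x != y -> drop k.+1 x = drop k.+1 y ->
  count (common b t x y) (words m) + 'C(m - k, t) <= binsum m t.+1.
Proof.
move=> kb sxy xy; case: t => [|t].
  by rewrite common_t0 // binsum_recr binsum0 !bin0.
elim: m k kb x y sxy xy => [|m IH] k kb x y sxy xy dxy.
  by rewrite sub0n bin0n addn0 binsum0l count_words0; case: common.
case: x y sxy xy dxy => [|a x] [|c y] // [sxy] xy.
have [ac | ac] := eqVneq a c.
  subst c.
  case: k kb => [|k] kb dxy; first by rewrite /= !drop0 in dxy; rewrite dxy eqxx in xy.
  rewrite eqseq_cons eqxx /= in xy.
  have {}IH := IH _ (ltnW kb) _ _ sxy xy dxy.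
  have avx : avoids b 1 (~~ a) (a :: x) by apply/avoids1/head_neq.
  have {avx} := count_common_avoidsl m t.+1 (a :: y) avx.
  rewrite (count_wordsS _ _ a) (eq_count (common_cons _ _ _ _ _)).
  by rewrite binsum_pascal !subSS subn0; lia.
have -> : c = ~~ a by case: (a) (c) ac => -[].
move=> dxy {IH ac}.
have nthb : b < size (a :: x) -> nth false (a :: x) b = nth false (~~ a :: y) b.
  by move=> _; rewrite -(subnKC kb) -!nth_drop dxy.
have binle : 'C(m.+1 - k, t.+1) <= 'C(m.+1, t.+1) by apply/leq_bin2l/leq_subr.
rewrite binsum2 /=.
have [xba | xba] := eqVneq (nth false (a :: x) b) a.
  have av : avoids b 2 (~~ a) (a :: x).
    by apply: avoids2 (head_neq a x) _ => _; rewrite xba; case: (a).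
  have := @count_common_heads b m t.+1 _ _ _ _ _ (avoids1 (head_negb_neq a y)) av.
  by rewrite !subSS !subn0; lia.
have av : avoids b 2 a (~~ a :: y).
  apply: avoids2 (head_negb_neq a y) _ => bx; rewrite -nthb //; move: bx => /=; lia.
have := @count_common_heads b m t.+1 _ _ _ _ _ av (avoids1 (head_neq a x)).
by rewrite !subSS !subn0; lia.
Qed.

Lemma avoids2_or_greedy b a x : 0 < b ->
  avoids b 2 (~~ a) (a :: x) \/ (b <= size x /\ nth false x b.-1 = ~~ a).
Proof.
move=> b0; have [bx | bx] := leqP b (size x); last first.
  by left; apply: avoids2 (head_neq a x) _; rewrite /= ltnS leqNgt bx.
have [xb | xb] := eqVneq (nth false x b.-1) (~~ a); first by right.
left; apply: avoids2 (head_neq a x) _ => _.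
by case: b b0 xb {bx}.
Qed.

Lemma count_common_le b m t x y : 1 < b -> size x = size y -> x != y ->
  count (common b t x y) (words m) + 'C(m.+1 - b, t) <= binsum m t.+1.
Proof.
move=> b1; elim: m t x y => [|m IH] t x y sxy xy; (case: t => [|t]; first
  by rewrite common_t0 // binsum_recr binsum0 !bin0).
  by rewrite (_ : 1 - b = 0) ?bin0n ?addn0 ?binsum0l ?count_words0; [case: common|lia].
have [mb | bm] := ltnP m.+1 b.
  rewrite (_ : m.+2 - b = 0); last lia.
  rewrite bin0n addn0; apply: leq_trans (count_emb_le b t.+1 x m.+1).
  by apply: sub_count => z /andP[].
case: x y sxy xy => [|a x] [|c y] // [sxy] xy.
have binle : 'C(m.+1 - b, t) <= 'C(m, t) by apply: leq_bin2l; lia.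
have [ac | ac] := eqVneq a c; last first.
  have -> : c = ~~ a by case: (a) (c) ac => -[].
  have := @count_common_heads b m t.+1 _ _ _ _ _
    (avoids1 (head_negb_neq a y)) (avoids1 (head_neq a x)).
  have : 'C(m.+2 - b, t.+1) <= 'C(m, t.+1) by apply: leq_bin2l; lia.
  rewrite binsum_pascal (binsum_recr m t.+1) !subSS subn0; lia.
subst c.
have b0 : 0 < b by lia.
have xy' : x != y by move: xy; rewrite eqseq_cons eqxx.
(* Branch [a] loses ['C(m.+1 - b, t.+1)] words by induction, so by Pascal's rule it is enough that
   branch [~~ a] loses ['C(m.+1 - b, t)]. *)
have loss : count (fun z => common b t.+1 (a :: x) (a :: y) (~~ a :: z)) (words m)
      + 'C(m.+1 - b, t) <= binsum m t.+1 ->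
    count (common b t.+1 (a :: x) (a :: y)) (words m.+1) + 'C(m.+2 - b, t.+1)
      <= binsum m.+1 t.+2.
  have := IH t.+1 x y sxy xy'.
  rewrite (count_wordsS _ _ a) (eq_count (common_cons _ _ _ _ _)).
  by rewrite (subSn bm) binS binsum_pascal; lia.
have [avx | [bx xb]] := avoids2_or_greedy a x b0.
  apply: loss; have := count_common_avoidsl m t.+1 (a :: y) avx.
  by rewrite !subSS subn0 binsum_recr; lia.
have [avy | [by_ yb]] := avoids2_or_greedy a y b0.
  apply: loss; have := count_common_avoidsr m t.+1 (a :: x) avy.
  by rewrite !subSS subn0 binsum_recr; lia.
have [dxy | dxy] := eqVneq (drop b x) (drop b y); last first.
  apply: loss; rewrite (eq_count (a2 := common b t (drop b x) (drop b y))).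
    by apply: IH; rewrite ?size_drop ?sxy.
  by move=> z; rewrite /common !emb_greedy.
(* Both words carry [~~ a] at position [b] and agree afterwards, so the window lemma applies with
   [k = b.-1]. *)
rewrite (_ : m.+2 - b = m.+1 - b.-1); last lia.
apply: count_common_window; rewrite ?prednK //=; first by rewrite sxy.
by rewrite !drop_cons_nth // xb yb dxy.
Qed.

(** * Words attaining the bounds *)

Definition alternating b x :=
  forall i, i + b < size x -> nth false x (i + b) = ~~ nth false x i.

Lemma alternating_drop b k x : alternating b x -> alternating b (drop k x).
Proof.
move=> alt i; rewrite size_drop !nth_drop addnA => ib.
by apply: alt; lia.
Qed.

Lemma alternating_behead b a x : alternating b (a :: x) -> alternating b x.
Proof. by move/(@alternating_drop _ 1); rewrite /= drop0. Qed.

Lemma alternating_head b a x : 0 < b -> alternating b (a :: x) ->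
  b <= size x -> nth false x b.-1 = ~~ a.
Proof. by case: b => // b _ alt bx; apply: (alt 0). Qed.

Lemma count_emb_alternating b m t x : 0 < b -> size x = m + b * t ->
  alternating b x -> binsum m t.+1 <= count (emb b t x) (words m).
Proof.
move=> b0; elim: m t x => [|m IH] t x sx alt.
  by rewrite count_words0 binsum0l emb_nil sx eqxx.
case: x sx alt => [|a x] // [sx] alt.
have altx := alternating_behead alt.
rewrite binsum_pascal (count_wordsS _ _ a) (eq_count (emb_cons _ _ _ _)).
apply: leq_add; first exact: IH.
case: t sx => [|t] sx; first by rewrite binsum0.
rewrite mulnS in sx; have bx : b <= size x by lia.
rewrite (eq_count (a2 := emb b t (drop b x))).
  by apply: IH; [rewrite size_drop; lia|apply: alternating_drop].
by move=> z; apply: emb_greedy => //; apply: alternating_head alt _.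
Qed.

Lemma drop_cat_cons k (p : seq bool) a c x : size p < k ->
  drop k (p ++ a :: x) = drop k (p ++ c :: x).
Proof.
move=> pk; rewrite !drop_cat ltnNge (ltnW pk) /=.
by case E: (k - size p) => [|d] //; lia.
Qed.

(** Before the flip, a branch spending a burst jumps past the flipped letter and loses nothing; the
    whole loss arises at the flip itself. *)
Lemma count_common_flip b m t p a x : size p < b ->
  size (p ++ a :: x) = m + b * t -> alternating b (p ++ a :: x) ->
  binsum m t.+1 <=
    count (common b t (p ++ a :: x) (p ++ ~~ a :: x)) (words m)
      + 'C(m - size p, t).
Proof.
case: t => [|t]; first by rewrite bin0 binsum_recr binsum0 bin0; lia.
rewrite mulnS; elim: p m => [|d p IH] [|m] pb sx alt.
1,3: rewrite count_words0 binsum0l /common !emb_nil mulnS;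
  by move: sx; rewrite !size_cat /= add0n => ->; rewrite eqxx.
  have b0 : 0 < b by [].
  rewrite /= in sx alt *; have bx : b <= size x by lia.
  have xb := alternating_head b0 alt bx.
  have dx c : drop b (c :: x) = ~~ a :: drop b x by rewrite drop_cons_nth ?xb.
  have altx := alternating_drop (k := b) (alternating_behead alt).
  rewrite binsum2 (count_wordsS _ _ (~~ a)) subn0 leq_add2r; apply: leq_add.
    apply: leq_trans (count_emb_alternating b0 _ altx) _.
      by rewrite size_drop; lia.
    apply: sub_count => z e; rewrite /common emb_greedy // e emb_cons.
    exact: emb_skip.
  (* For outputs starting with [a], the flipped word reads [~~ a] at positions 0 and [b] and reaches
     [a] only at [2b], after two bursts. *)
  case: t sx => [|t] sx; first by rewrite binsum0.
  rewrite mulnS in sx; have bbx : b <= size (drop b x) by rewrite size_drop; lia.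
  have xbb : nth false (drop b x) b.-1 = a.
    have alt' := alternating_drop (k := b) alt; rewrite dx in alt'.
    by rewrite (alternating_head b0 alt' bbx) negbK.
  have altxx := alternating_drop (k := b) altx.
  apply: leq_trans (count_emb_alternating b0 _ altxx) _.
    by rewrite !size_drop; lia.
  apply: sub_count => z e; rewrite negbK /common emb_cons; apply/andP; split.
    by do 2!apply: emb_skip => //.
  apply: emb_skip => /=; first lia.
  rewrite dx; apply: emb_skip => /=; first lia.
  by rewrite drop_cons_nth // xbb emb_cons.
have b0 : 0 < b by lia.
rewrite /= in pb sx; rewrite !cat_cons in alt *.
have bx : b <= size (p ++ a :: x) by lia.
have xb := alternating_head b0 alt bx.
rewrite binsum_pascal subSS (count_wordsS _ _ d) (eq_count (common_cons _ _ _ _ _)).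
have {}IH := IH m (ltnW pb) _ (alternating_behead alt).
have altx := alternating_drop (k := b) (alternating_behead alt).
rewrite addnAC; apply: leq_add; first by apply: IH; lia.
apply: leq_trans (count_emb_alternating b0 _ altx) _.
  by rewrite size_drop; lia.
apply: sub_count => z e; rewrite /common emb_greedy // e /=.
apply: emb_skip; first by move: bx; rewrite /= !size_cat /=; lia.
by rewrite -cat_cons -(drop_cat_cons a) //= drop_cons_nth // xb emb_cons.
Qed.

(** * Closed forms for the largest ball and the largest intersection *)

Definition alt_word b n := mkseq (fun i => odd (i %/ b)) n.

Lemma alternating_alt_word b n : 0 < b -> alternating b (alt_word b n).
Proof.
move=> b0 i; rewrite size_mkseq => ib; rewrite !nth_mkseq //; last lia.
by rewrite divnDr // divnn b0 addn1.
Qed.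

(** The convention 1 at [m = b * s] equals [binsum 0 s.+1], so one formula covers both cases. *)
Lemma Dmax_natE b m (s : nat) : 0 < b ->
  Dmax b m s = if m < b * s then 0 else binsum (m - b * s) s.+1.
Proof.
move=> b0 /=; case: ltnP => // sm.
case: eqVneq => [->|_]; first by rewrite subnn binsum0l.
apply/eqP; rewrite eqn_leq; apply/andP; split.
  apply/bigmax_leqP => x _; rewrite (@DcardE _ _ (m - b * s)).
    exact: count_emb_le.
  by rewrite size_tuple; lia.
have sz : size (alt_word b m) == m by rewrite size_mkseq.
apply: leq_trans (leq_bigmax (Tuple sz)).
rewrite (@DcardE _ _ (m - b * s)) ?size_tuple ?subnK //=.
apply: count_emb_alternating => //; last exact: alternating_alt_word.
by rewrite size_mkseq subnK.
Qed.

Lemma Nminus_add_bin b n t : 1 < b -> b <= n -> b * t <= n ->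
  Nminus b n t + 'C((n - b * t).+1 - b, t) = binsum (n - b * t) t.+1.
Proof.
move=> b1 bn tn; have b0 : 0 < b by lia.
set m := n - b * t; have nE : n = m + b * t by rewrite subnK.
(* A prefix of length [b.-1] is the longest that [count_common_flip] allows, and makes its loss
   equal to that of the upper bound. *)
have [p [a [w [pb xE]]]] : exists p a w, size p = b.-1 /\ alt_word b n = p ++ a :: w.
  exists (take b.-1 (alt_word b n)), (nth false (alt_word b n) b.-1),
    (drop b.-1.+1 (alt_word b n)).
  rewrite size_takel ?size_mkseq; last lia.
  by rewrite -drop_nth ?size_mkseq ?cat_take_drop //; lia.
have sx : size (p ++ a :: w) == n by rewrite -xE size_mkseq.
have sy : size (p ++ ~~ a :: w) == n by rewrite -(eqP sx) !size_cat.
have yx : Tuple sy != Tuple sx.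
  by rewrite -val_eqE /= eqseq_cat // eqxx eqseq_cons; case: (a).
have upper (x y : n.-tuple bool) : y != x ->
    Icard b t x y + 'C(m.+1 - b, t) <= binsum m t.+1.
  move=> xy; rewrite (@IcardE _ _ m) ?size_tuple //.
  by apply: count_common_le; rewrite ?size_tuple // eq_sym.
apply/eqP; rewrite eqn_leq; apply/andP; split.
  have : Nminus b n t <= binsum m t.+1 - 'C(m.+1 - b, t).
    apply/bigmax_leqP => x _; apply/bigmax_leqP => y xy.
    by have := upper _ _ xy; lia.
  (* Any distinct pair shows that the binomial is at most [binsum m t.+1], so the subtraction is not
     truncated. *)
  by have := upper _ _ yx; lia.
have lower : binsum m t.+1 <= Icard b t (Tuple sx) (Tuple sy) + 'C(m.+1 - b, t).
  rewrite (@IcardE _ _ m) ?size_tuple // (_ : m.+1 - b = m - size p); last lia.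
  apply: count_common_flip; [lia|by rewrite (eqP sx)|].
  by rewrite -xE; apply: alternating_alt_word.
apply: leq_trans lower _; rewrite leq_add2r.
have := @leq_bigmax_cond _ [pred y | y != Tuple sx]
  (fun y : n.-tuple bool => Icard b t (Tuple sx) y) (Tuple sy) yx.
move/leq_trans; apply.
exact: (@leq_bigmax _ (fun x : n.-tuple bool =>
  \max_(y : n.-tuple bool | y != x) Icard b t x y) (Tuple sx)).
Qed.

Local Open Scope ring_scope.

Theorem theorem4p10 (b t n : nat) :
  (2 <= b)%N -> (1 <= t)%N -> ((t.+1) * b - 1 <= n)%N ->
  [/\ (Nminus b n t)%:Z =
        (Dmax b n t)%:Z - (Dmax b (n%:Z - b%:Z) t)%:Z
        + (Dmax b (n%:Z - 3 * b%:Z) (t%:Z - 2))%:Z,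
      (Nminus b n t)%:Z = (Dmax b n t)%:Z - ('C(n + 1 - t.+1 * b, t))%:Z
    & Dmax b n t = (\sum_(i < t.+1) 'C(n - b * t, i))%N].
Proof.
move=> b1 t1; rewrite mulSn => nb.
have b0 : (0 < b)%N by lia.
have tn : (b * t <= n)%N by lia.
have bn : (b <= n)%N by nia.
have DE : Dmax b n t = binsum (n - b * t) t.+1 by rewrite Dmax_natE // ltnNge tn.
have NE := Nminus_add_bin b1 bn tn.
rewrite -DE (_ : ((n - b * t).+1 - b = n + 1 - (b + t * b))%N) in NE; last lia.
(* With [m = n - b - b * t], also equal to [n - 3 * b - b * (t - 2)], the two maxima differ by
   ['C(m, t - 1) + 'C(m, t) = 'C(m.+1, t)]. *)
have loss : (Dmax b (n%:Z - b%:Z) t =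
    'C(n + 1 - (b + t * b), t) + Dmax b (n%:Z - 3 * b%:Z) (t%:Z - 2))%N.
  rewrite subzn // Dmax_natE //.
  case: t t1 nb tn {DE NE} => [|[|t]] // _ nb tn.
    (* For [t = 1] the second argument is negative and the last term is 0 by convention. *)
    rewrite (_ : 1%:Z - 2 = Negz 0) //
      (_ : Dmax _ _ (Negz 0) = 0%N); last by case: (_ - _).
    rewrite mul1n muln1 addn0 bin1 in nb *.
    by case: ltnP => h; [lia|rewrite !binsum_recr binsum0 bin0 bin1; lia].
  rewrite (_ : t.+2%:Z - 2 = t%:Z); last lia.
  case: ltnP => h.
    (* Here [n] takes its least allowed value, and all three terms vanish. *)
    rewrite (_ : (n + 1 - (b + t.+2 * b) = 0)%N); last lia.
    rewrite bin0n; case: (leqP (3 * b) n) => h3.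
      rewrite (_ : n%:Z - 3 * b%:Z = (n - 3 * b)%N); last lia.
      by rewrite Dmax_natE // (_ : (n - 3 * b < b * t)%N) //; lia.
    by case E: (n%:Z - 3 * b%:Z) => [k|k] //; lia.
  have h3 : (3 * b <= n)%N by lia.
  rewrite (_ : n%:Z - 3 * b%:Z = (n - 3 * b)%N); last lia.
  rewrite Dmax_natE // (_ : (n - 3 * b < b * t)%N = false); last lia.
  rewrite (_ : (n + 1 - (b + t.+2 * b) = (n - b - b * t.+2).+1)%N); last lia.
  rewrite (_ : (n - 3 * b - b * t = n - b - b * t.+2)%N); last lia.
  by rewrite binS !binsum_recr; lia.
split=> //; lia.
Qed.
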